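(* There exists a real number $c>0$ with the following property. For all $q\in\mathbb{Z}^+$ and all $g\in\mathbb{Z}^2$, if $\mathcal{N}(q(1/\beta,1/\beta^2)-g)<c$, then $$q(1/\beta,1/\beta^2)-g=\delta(q)\quad\text{or}\quad q(1/\beta,1/\beta^2)-g=\delta(q)-(1,1).$$
   Context: Let $a,b$ be integers with $-a+1\le b\le -2$, let $\beta$ be the real dominant root of $x^3-ax^2-bx-1$, and assume its conjugates $\alpha,\overline\alpha$ are non-real. Let $T_0=1$, $T_1=a$, $T_2=a^2+b$, $T_{n+3}=aT_{n+2}+bT_{n+1}+T_n$. Each $q\in\mathbb{Z}^+$ has a unique $T$-representation $q=\sum_{j=0}^{k}d_jT_j$ with $d_j\in\{0,\dots,a-1\}$, where every block satisfies $d_jd_{j-1}\cdots d_{j-m}\le_{\mathrm{lex}}(a-1)(a+b-1)(a+b)\cdots(a+b)$ (same length). For such $q$ we write $\delta(q)=q(1/\beta,1/\beta^2)-(\sum_{j\ge1}d_jT_{j-1},\sum_{j\ge2}d_jT_{j-2})$. The Rauzy norm is $\mathcal{N}(x_1,x_2)=|(\alpha+b/\beta)x_1+x_2/\beta|$. Standing assumption of the paper: the Rauzy fractal $\mathcal{R}=\{\sum_{i\ge2}d_i\alpha^i:(d_i)_{i\ge2}\text{ admissible}\}$ has exactly 6 neighbours. A neighbour is a nonzero translation vector $u$ of the associated lattice tiling with $\mathcal{R}\cap(\mathcal{R}+u)\neq\emptyset$. *)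

(* Defs.v *)
From Stdlib Require Import Reals ZArith List.
Open Scope R_scope.

Definition Cadd (z w : R * R) : R * R := (fst z + fst w, snd z + snd w).
Definition Csub (z w : R * R) : R * R := (fst z - fst w, snd z - snd w).
Definition Cmul (z w : R * R) : R * R :=
  (fst z * fst w - snd z * snd w, fst z * snd w + snd z * fst w).
Definition CR (x : R) : R * R := (x, 0).
Definition Cscale (x : R) (z : R * R) : R * R := (x * fst z, x * snd z).
Fixpoint Cpow (z : R * R) (n : nat) : R * R :=
  match n with O => (1, 0) | S n => Cmul z (Cpow z n) end.
Definition Cnorm (z : R * R) : R := sqrt (fst z ^ 2 + snd z ^ 2).

Definition Cchar (a b : Z) (z : R * R) : R * R :=
  Csub (Csub (Csub (Cpow z 3) (Cscale (IZR a) (Cpow z 2))) (Cscale (IZR b) z)) (CR 1).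

Fixpoint Ttrip (a b : Z) (n : nat) : Z * Z * Z :=
  match n with
  | O => (1%Z, a, (a * a + b)%Z)
  | S n => let '(x, y, z) := Ttrip a b n in (y, z, (a * z + b * y + x)%Z)
  end.
Definition T (a b : Z) (n : nat) : Z := fst (fst (Ttrip a b n)).

Fixpoint sumZ (f : nat -> Z) (n : nat) : Z :=
  match n with O => 0%Z | S n => (sumZ f n + f n)%Z end.

Fixpoint lexle (n : nat) (f g : nat -> Z) : Prop :=
  match n with
  | O => True
  | S n => (f O < g O)%Z \/
           (f O = g O /\ lexle n (fun t => f (S t)) (fun t => g (S t)))
  end.

Definition wref (a b : Z) (t : nat) : Z :=
  match t with O => (a - 1)%Z | 1%nat => (a + b - 1)%Z | _ => (a + b)%Z end.

Definition admissible (a b : Z) (d : nat -> Z) : Prop :=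
  (forall j, (0 <= d j <= a - 1)%Z) /\
  (forall j m : nat, (m <= j)%nat -> lexle (S m) (fun t => d (j - t)%nat) (wref a b)).

Definition Trep (a b : Z) (q : Z) (d : nat -> Z) (k : nat) : Prop :=
  admissible a b d /\ (forall j, (k < j)%nat -> d j = 0%Z) /\
  q = sumZ (fun j => (d j * T a b j)%Z) (S k).

(** delta(q) = q(1/beta, 1/beta^2) - (sum_{j>=1} d_j T_{j-1}, sum_{j>=2} d_j T_{j-2}),
    for a T-representation d of q with digits vanishing above k. *)
Definition delta (a b : Z) (beta : R) (q : Z) (d : nat -> Z) (k : nat) : R * R :=
  (IZR q / beta - IZR (sumZ (fun j => (d (S j) * T a b j)%Z) k),
   IZR q / beta ^ 2 - IZR (sumZ (fun j => (d (S (S j)) * T a b j)%Z) k)).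

Definition rauzy_norm (b : Z) (beta : R) (alpha : R * R) (x : R * R) : R :=
  Cnorm (Cadd (Cscale (fst x) (Cadd alpha (CR (IZR b / beta)))) (CR (snd x / beta))).

(** ** The Rauzy fractal  { sum_{i>=2} d_i alpha^i : (d_i)_{i>=2} admissible }.
    The sequence (d_i)_{i>=2} is encoded as e with e k = d_{k+2}; admissibility
    of (d_i)_{i>=2} is admissibility of e (blocks inside the index range). *)
Definition rauzy_fractal (a b : Z) (alpha : R * R) (z : R * R) : Prop :=
  exists e : nat -> Z, admissible a b e /\
    infinite_sum (fun k => fst (Cscale (IZR (e k)) (Cpow alpha (k + 2)))) (fst z) /\
    infinite_sum (fun k => snd (Cscale (IZR (e k)) (Cpow alpha (k + 2)))) (snd z).

(** Translation lattice of the lattice tiling associated with this Rauzy fractal: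
    alpha^2 * ( Z (1 - r1) + Z (1 - r2) ) where r1 = alpha - (a-1),
    r2 = alpha r1 - (a+b-1) are the conjugates of T_beta(1), T_beta^2(1);
    i.e. 1 - r1 = a - alpha,  1 - r2 = a + b + (a-1) alpha - alpha^2. *)
Definition tiling_lattice (a b : Z) (alpha : R * R) (u : R * R) : Prop :=
  exists m n : Z,
    u = Cmul (Cpow alpha 2)
          (Cadd (Cscale (IZR m) (Csub (CR (IZR a)) alpha))
                (Cscale (IZR n)
                   (Csub (Cadd (CR (IZR (a + b))) (Cscale (IZR (a - 1)) alpha))
                         (Cpow alpha 2)))).

Definition neighbour (a b : Z) (alpha : R * R) (u : R * R) : Prop :=
  tiling_lattice a b alpha u /\ u <> (0, 0) /\
  exists z, rauzy_fractal a b alpha z /\ rauzy_fractal a b alpha (Csub z u).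

Definition six_neighbours (a b : Z) (alpha : R * R) : Prop :=
  exists l : list (R * R), length l = 6%nat /\ NoDup l /\
    forall u, In u l <-> neighbour a b alpha u.

(* Main.v *)
From Stdlib Require Import Reals ZArith List Lra Lia FinFun ClassicalEpsilon.
From Coquelicot Require Import Coquelicot.
Require Import Defs.
Import ListNotations.
Open Scope R_scope.

(** If [d] represents [q], then up to the factor [|alpha| beta] the Rauzy norm of
    [q (1/beta, 1/beta^2) - g] is the distance from the point
    [z = sum_j d_j alpha^(j+2)] of the fractal [R] to the lattice point
    [u(h) = h1 alpha^2 (a - alpha) - h2 alpha], where [h] is the difference between
    [g] and the integer vector in [delta q].  Since [R] is compact and the lattice
    discrete, it suffices that [u(h)] lies in [R] only for [h = (0,0)] and
    [h = (1,1)].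

    Explicit expansions, ultimately constant equal to [a + b], show that
    [+-u(1,0)], [+-u(1,1)], [+-u(0,1)] are always neighbours, so under the
    hypothesis there are no others.  If [u(h)] lies in [R], then, [0] and [u(1,1)]
    lying in [R] too, [h] and [h - (1,1)] are both zero or among these six, which
    leaves [(0,0)], [(1,1)], [(0,1)] and [(1,0)].  For the last two, dropping the
    first digit of the expansion of [u(h)] gives a point of [R] which differs from
    [0], respectively from the value of the constant expansion [a + b], by a
    nonzero lattice vector that is not a neighbour. *)

(** * Complex moduli and geometrically dominated series *)

Lemma C_pair_eq (z w : C) : fst z = fst w -> snd z = snd w -> z = w.
Proof. destruct z, w; simpl; intros; subst; reflexivity. Qed.

(** [Cadd], [Csub], [Cmul] and [CR] are convertible with Coquelicot's operations, so later proofs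
    pass between them by [change]; scaling is the case that needs rewriting. *)
Lemma Cscale_mult (x : R) (z : C) : Cscale x z = Cmult (RtoC x) z.
Proof. apply C_pair_eq; unfold Cscale; simpl; ring. Qed.

Lemma Cmod_Cpow (z : C) (n : nat) : Cmod (Cpow z n) = Cmod z ^ n.
Proof.
  induction n as [|n IH]; simpl; [exact Cmod_1|].
  change (Cmul z (Cpow z n)) with (Cmult z (Cpow z n)).
  now rewrite Cmod_mult, IH.
Qed.

Lemma Rabs_fst_le_Cmod (z : C) : Rabs (fst z) <= Cmod z.
Proof. eapply Rle_trans; [apply Rmax_l | apply Rmax_Cmod]. Qed.

Lemma Rabs_snd_le_Cmod (z : C) : Rabs (snd z) <= Cmod z.
Proof. eapply Rle_trans; [apply Rmax_r | apply Rmax_Cmod]. Qed.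

Lemma Cmod_le_sum (z : C) : Cmod z <= Rabs (fst z) + Rabs (snd z).
Proof.
  unfold Cmod. apply Rsqr_incr_0_var.
  - rewrite Rsqr_sqrt by nra. unfold Rsqr.
    pose proof (Rabs_pos (fst z)); pose proof (Rabs_pos (snd z)).
    rewrite <- (pow2_abs (fst z)), <- (pow2_abs (snd z)). nra.
  - pose proof (Rabs_pos (fst z)); pose proof (Rabs_pos (snd z)); lra.
Qed.

Lemma ex_series_geom_dominated (f : nat -> R) (M r : R) :
  0 <= r < 1 -> (forall k, Rabs (f k) <= M * r ^ k) -> ex_series f.
Proof.
  intros Hr Hf. apply (ex_series_le f (fun k => M * r ^ k)); [exact Hf|].
  apply (ex_series_scal_l (V := R_NormedModule) M (pow r)), ex_series_geom.
  rewrite Rabs_pos_eq; lra.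
Qed.

Lemma Series_geom_dominated (f : nat -> R) (M r : R) :
  0 <= r < 1 -> (forall k, Rabs (f k) <= M * r ^ k) ->
  Rabs (Series f) <= M / (1 - r).
Proof.
  intros Hr Hf.
  assert (Hg : ex_series (fun k => M * r ^ k))
    by (apply (ex_series_scal_l (V := R_NormedModule) M (pow r)), ex_series_geom;
        rewrite Rabs_pos_eq; lra).
  eapply Rle_trans.
  - apply Series_Rabs.
    apply (ex_series_le (fun k => Rabs (f k)) (fun k => M * r ^ k)); [|exact Hg].
    intro k. change (norm (Rabs (f k))) with (Rabs (Rabs (f k))).
    rewrite Rabs_Rabsolu. apply Hf.
  - eapply Rle_trans.
    + apply (Series_le _ (fun k => M * r ^ k)); [|exact Hg].
      intro k; split; [apply Rabs_pos | apply Hf].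
    + rewrite Series_scal_l, Series_geom by (rewrite Rabs_pos_eq; lra).
      unfold Rdiv; lra.
Qed.

(** * Digit expansions in base [alpha] *)

Definition shift (e : nat -> Z) (n k : nat) : Z := e (n + k)%nat.

Definition bounded_digits (a : Z) (e : nat -> Z) : Prop :=
  forall j, (0 <= e j <= a - 1)%Z.

(** The coordinates are summed separately so that the total real operator [Series] applies; its
    value is meaningful once [ex_series_expansion] gives convergence. The exponent [k + 2] matches
    the indexing of the fractal by digits [d_i] with [i >= 2]. *)
Definition expansion (alpha : C) (e : nat -> Z) : C :=
  (Series (fun k => IZR (e k) * fst (Cpow alpha (k + 2))),
   Series (fun k => IZR (e k) * snd (Cpow alpha (k + 2)))).

Lemma expansion_term_bound (a : Z) (alpha : C) (e : nat -> Z) (k : nat) :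
  Cmod alpha < 1 -> bounded_digits a e ->
  Rabs (IZR (e k) * fst (Cpow alpha (k + 2))) <= IZR (a - 1) * Cmod alpha ^ k /\
  Rabs (IZR (e k) * snd (Cpow alpha (k + 2))) <= IZR (a - 1) * Cmod alpha ^ k.
Proof.
  intros Hr He. pose proof (Cmod_ge_0 alpha) as H0.
  assert (Hp : Cmod (Cpow alpha (k + 2)) <= Cmod alpha ^ k).
  { rewrite Cmod_Cpow, pow_add. pose proof (pow_le (Cmod alpha) k H0).
    assert (Cmod alpha ^ 2 <= 1) by (simpl; nra). nra. }
  assert (Hd : Rabs (IZR (e k)) <= IZR (a - 1)).
  { rewrite Rabs_pos_eq; apply IZR_le; apply He. }
  rewrite !Rabs_mult.
  split; (apply Rmult_le_compat; [apply Rabs_pos | apply Rabs_pos | exact Hd |]);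
    (eapply Rle_trans; [|exact Hp]).
  - apply Rabs_fst_le_Cmod.
  - apply Rabs_snd_le_Cmod.
Qed.

Lemma ex_series_expansion (a : Z) (alpha : C) (e : nat -> Z) :
  Cmod alpha < 1 -> bounded_digits a e ->
  ex_series (fun k => IZR (e k) * fst (Cpow alpha (k + 2))) /\
  ex_series (fun k => IZR (e k) * snd (Cpow alpha (k + 2))).
Proof.
  intros Hr He. pose proof (Cmod_ge_0 alpha).
  split; apply (ex_series_geom_dominated _ (IZR (a - 1)) (Cmod alpha)); try lra;
    intro k; now apply (expansion_term_bound a alpha e k).
Qed.

(** The factor 2 comes from bounding the modulus by the sum of the absolute values of the two
    coordinates. *)
Lemma Cmod_expansion_le (a : Z) (alpha : C) (e : nat -> Z) :
  Cmod alpha < 1 -> bounded_digits a e ->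
  Cmod (expansion alpha e) <= 2 * (IZR (a - 1) / (1 - Cmod alpha)).
Proof.
  intros Hr He. pose proof (Cmod_ge_0 alpha).
  eapply Rle_trans; [apply Cmod_le_sum|]. simpl.
  assert (H1 := Series_geom_dominated
    (fun k => IZR (e k) * fst (Cpow alpha (k + 2))) (IZR (a - 1)) (Cmod alpha)
    (conj H Hr) (fun k => proj1 (expansion_term_bound a alpha e k Hr He))).
  assert (H2 := Series_geom_dominated
    (fun k => IZR (e k) * snd (Cpow alpha (k + 2))) (IZR (a - 1)) (Cmod alpha)
    (conj H Hr) (fun k => proj2 (expansion_term_bound a alpha e k Hr He))).
  lra.
Qed.

Lemma expansion_ext (alpha : C) (e f : nat -> Z) :
  (forall k, e k = f k) -> expansion alpha e = expansion alpha f.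
Proof.
  intros H. apply C_pair_eq; simpl; apply Series_ext; intro k; now rewrite H.
Qed.

Lemma expansion_step (a : Z) (alpha : C) (e : nat -> Z) :
  Cmod alpha < 1 -> bounded_digits a e ->
  expansion alpha e =
  (IZR (e 0%nat) * (alpha * alpha) + alpha * expansion alpha (shift e 1))%C.
Proof.
  intros Hr He.
  assert (He' : bounded_digits a (shift e 1)) by (intro j; apply He).
  destruct (ex_series_expansion a alpha e Hr He) as [E1 E2].
  destruct (ex_series_expansion a alpha _ Hr He') as [F1 F2].
  apply C_pair_eq; unfold expansion.
  (* The right side is spelled out in coordinates; the term with factor 0 is the imaginary part of
     the real scalar [e 0]. *)
  - change (Series (fun k => IZR (e k) * fst (Cpow alpha (k + 2))) =
      IZR (e 0%nat) * (fst alpha * fst alpha - snd alpha * snd alpha)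
      - 0 * (fst alpha * snd alpha + snd alpha * fst alpha)
      + (fst alpha * Series (fun k => IZR (e (S k)) * fst (Cpow alpha (k + 2)))
      - snd alpha * Series (fun k => IZR (e (S k)) * snd (Cpow alpha (k + 2))))).
    rewrite (Series_incr_1 _ E1), <- !Series_scal_l, <- Series_minus.
    + f_equal; [simpl; ring | apply Series_ext; intro k; simpl; ring].
    + exact (ex_series_scal_l (V := R_NormedModule) (fst alpha) _ F1).
    + exact (ex_series_scal_l (V := R_NormedModule) (snd alpha) _ F2).
  - change (Series (fun k => IZR (e k) * snd (Cpow alpha (k + 2))) =
      IZR (e 0%nat) * (fst alpha * snd alpha + snd alpha * fst alpha)
      + 0 * (fst alpha * fst alpha - snd alpha * snd alpha)
      + (fst alpha * Series (fun k => IZR (e (S k)) * snd (Cpow alpha (k + 2)))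
      + snd alpha * Series (fun k => IZR (e (S k)) * fst (Cpow alpha (k + 2))))).
    rewrite (Series_incr_1 _ E2), <- !Series_scal_l, <- Series_plus.
    + f_equal; [simpl; ring | apply Series_ext; intro k; simpl; ring].
    + exact (ex_series_scal_l (V := R_NormedModule) (fst alpha) _ F2).
    + exact (ex_series_scal_l (V := R_NormedModule) (snd alpha) _ F1).
Qed.

Fixpoint expansion_prefix (alpha : C) (e : nat -> Z) (n : nat) : C :=
  match n with
  | O => 0%C
  | S n => (expansion_prefix alpha e n + IZR (e n) * Cpow alpha (n + 2))%C
  end.

(** Iterates [expansion_step]. The tail carries the factor [alpha^n], so two expansions with the
    same first [n] digits are exponentially close. *)
Lemma expansion_split (a : Z) (alpha : C) (e : nat -> Z) (n : nat) :
  Cmod alpha < 1 -> bounded_digits a e ->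
  expansion alpha e =
  (expansion_prefix alpha e n + Cpow alpha n * expansion alpha (shift e n))%C.
Proof.
  intros Hr He. induction n as [|n IH].
  - rewrite (expansion_ext alpha (shift e 0) e) by reflexivity. simpl.
    change (1, 0) with (RtoC 1). ring.
  - rewrite IH.
    rewrite (expansion_step a alpha (shift e n)) by (try intro; auto; apply He).
    rewrite (expansion_ext alpha (shift (shift e n) 1) (shift e (S n))).
    2: { intro k. unfold shift. f_equal. lia. }
    unfold shift at 1. rewrite Nat.add_0_r. simpl.
    rewrite Nat.add_comm. simpl.
    change Cmul with Cmult. ring.
Qed.

Lemma expansion_prefix_ext (alpha : C) (e f : nat -> Z) (n : nat) :
  (forall i, (i < n)%nat -> e i = f i) ->
  expansion_prefix alpha e n = expansion_prefix alpha f n.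
Proof.
  induction n as [|n IH]; intros H; simpl; [reflexivity|].
  rewrite IH, H by auto. reflexivity.
Qed.

Lemma rauzy_fractal_expansion (a b : Z) (alpha : C) (e : nat -> Z) :
  Cmod alpha < 1 -> admissible a b e -> rauzy_fractal a b alpha (expansion alpha e).
Proof.
  intros Hr He. destruct (ex_series_expansion a alpha e Hr (proj1 He)) as [E1 E2].
  exists e. split; [exact He|].
  split; apply is_series_Reals, Series_correct; assumption.
Qed.

Lemma rauzy_fractal_inv (a b : Z) (alpha z : C) :
  rauzy_fractal a b alpha z -> exists e, admissible a b e /\ z = expansion alpha e.
Proof.
  intros [e [He [H1 H2]]]. exists e. split; [exact He|].
  apply is_series_Reals, is_series_unique in H1.
  apply is_series_Reals, is_series_unique in H2.
  apply C_pair_eq; symmetry; assumption.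
Qed.

(** * Admissible sequences *)

Lemma lexle_ext (n : nat) (f f' g : nat -> Z) :
  (forall t, (t < n)%nat -> f t = f' t) -> lexle n f g -> lexle n f' g.
Proof.
  revert f f' g. induction n as [|n IH]; intros f f' g H; simpl; [auto|].
  rewrite (H O) by lia. intros [L|[L1 L2]]; [left; exact L|right; split; [exact L1|]].
  revert L2. apply IH. intros t Ht. apply H. lia.
Qed.

Lemma admissible_bounded (a b : Z) (e : nat -> Z) :
  admissible a b e -> bounded_digits a e.
Proof. exact (@proj1 _ _). Qed.

Lemma admissible_shift (a b : Z) (e : nat -> Z) (n : nat) :
  admissible a b e -> admissible a b (shift e n).
Proof.
  intros [H1 H2]. split; [intro j; apply H1|].
  intros j m Hm. apply (lexle_ext _ (fun t => e (n + j - t)%nat)).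
  - intros t Ht. unfold shift. f_equal. lia.
  - apply H2. lia.
Qed.

(** Blocks are read towards lower indices, and the first letter decides the comparison unless it is
    [a - 1]. Then a zero follows, compared with [a + b - 1 >= 0]; in case of equality the next zero
    is compared with [a + b = 1]. *)
Lemma admissible_of_isolated_max (a b : Z) (d : nat -> Z) :
  (- a + 1 <= b)%Z -> bounded_digits a d ->
  (forall j, d (S j) = (a - 1)%Z -> d j = 0%Z /\ forall i, j = S i -> d i = 0%Z) ->
  admissible a b d.
Proof.
  intros Hab Hd Hmax. split; [exact Hd|].
  intros j m Hm. pose proof (Hd j).
  change (lexle (S m) (fun t => d (j - t)%nat) (wref a b)) with
    ((d (j - 0)%nat < a - 1)%Z \/ d (j - 0)%nat = (a - 1)%Z /\
     lexle m (fun t => d (j - S t)%nat) (fun t => wref a b (S t))).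
  rewrite Nat.sub_0_r.
  destruct (Z.eq_dec (d j) (a - 1)) as [E|E]; [right|left; lia].
  split; [exact E|].
  destruct m as [|m]; [exact I|]. destruct j as [|j]; [lia|].
  destruct (Hmax j E) as [E0 E1].
  change (lexle (S m) (fun t => d (S j - S t)%nat) (fun t => wref a b (S t))) with
    ((d (j - 0)%nat < a + b - 1)%Z \/ d (j - 0)%nat = (a + b - 1)%Z /\
     lexle m (fun t => d (j - S t)%nat) (fun t => wref a b (S (S t)))).
  rewrite Nat.sub_0_r, E0.
  destruct (Z.eq_dec 0 (a + b - 1)) as [E'|E']; [right|left; lia].
  split; [exact E'|].
  destruct m as [|m]; [exact I|]. destruct j as [|j]; [lia|].
  left. simpl. rewrite Nat.sub_0_r, (E1 j) by reflexivity. lia.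
Qed.

(** * The translation lattice *)

(** [cc_trace], [cc_pairs] and [cc_norm] are Vieta's formulas for the roots [beta], [alpha] and the
    conjugate of [alpha]. *)
Record cubic_conjugate (a b : Z) (beta : R) (alpha : C) : Prop := {
  cc_coeff : (- a + 1 <= b <= -2)%Z;
  cc_nonreal : snd alpha <> 0;
  cc_trace : beta + 2 * fst alpha = IZR a;
  cc_pairs : IZR b = - (2 * beta * fst alpha + (fst alpha ^ 2 + snd alpha ^ 2));
  cc_norm : beta * (fst alpha ^ 2 + snd alpha ^ 2) = 1;
  cc_root : (alpha * alpha * alpha =
             IZR a * (alpha * alpha) + IZR b * alpha + 1)%C;
  cc_beta : 1 < beta;
  cc_small : Cmod alpha < 1 }.

Lemma cubic_conjugate_intro (a b : Z) (beta : R) (alpha : C) :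
  (- a + 1 <= b <= -2)%Z ->
  beta ^ 3 - IZR a * beta ^ 2 - IZR b * beta - 1 = 0 ->
  Cchar a b alpha = (0, 0) -> snd alpha <> 0 ->
  cubic_conjugate a b beta alpha.
Proof.
  intros Hab Hb Hc Hy.
  assert (Hroot : (alpha * alpha * alpha =
                   IZR a * (alpha * alpha) + IZR b * alpha + 1)%C).
  { unfold Cchar in Hc. rewrite !Cscale_mult in Hc. simpl in Hc.
    change Cmul with Cmult in Hc. change Csub with Cminus in Hc.
    change CR with RtoC in Hc. change (1, 0) with (RtoC 1) in Hc.
    change (0, 0) with (RtoC 0) in Hc.
    apply Ceq_minus. rewrite <- Hc. ring. }
  destruct alpha as [x y]. simpl in Hy |- *.
  set (N := x ^ 2 + y ^ 2).
  assert (HN : 0 < N) by (unfold N; nra).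
  assert (Him := f_equal snd Hroot). assert (Hre := f_equal fst Hroot).
  simpl in Him, Hre.
  (* [E1] is the imaginary part of the root equation divided by [y]. Eliminating [b] with it from
     the real part gives [E2]: the three roots, the third being [a - 2x], have product 1. *)
  assert (E1 : 4 * x ^ 2 - N - 2 * IZR a * x - IZR b = 0).
  { apply (Rmult_eq_reg_l y); [|exact Hy]. unfold N. nra. }
  assert (E2 : N * (IZR a - 2 * x) = 1) by (unfold N in *; nra).
  (* the cubic splits as (t - (a - 2x)) (t^2 - 2 x t + N) *)
  assert (E3 : (beta ^ 2 - 2 * x * beta + N) * (beta - (IZR a - 2 * x)) = 0).
  { replace (IZR b) with (4 * x ^ 2 - N - 2 * IZR a * x) in Hb by lra.
    ring_simplify. ring_simplify in Hb. nra. }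
  assert (Q : forall t, 0 < t ^ 2 - 2 * x * t + N).
  { intro t. replace (t ^ 2 - 2 * x * t + N) with ((t - x) ^ 2 + y ^ 2)
      by (unfold N; ring).
    pose proof (pow2_ge_0 (t - x)). pose proof (pow2_gt_0 y Hy). lra. }
  assert (E4 : beta + 2 * x = IZR a).
  { apply Rmult_integral in E3. specialize (Q beta). lra. }
  assert (E5 : beta * N = 1) by (rewrite <- E2, <- E4; ring).
  assert (E6 : 1 < beta).
  { specialize (Q 1).
    (* The factored cubic is evaluated at 1, where its value is [-(a + b) < 0]; its quadratic factor
       is positive there. *)
    assert (Hp : 0 < IZR a + IZR b) by (rewrite <- plus_IZR; apply IZR_lt; lia).
    assert (E7 : (1 ^ 2 - 2 * x * 1 + N) * (beta - 1) = IZR a + IZR b)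
      by (rewrite <- E4 in E1 |- *; lra).
    destruct (Rle_lt_dec beta 1); [exfalso | assumption].
    assert (0 <= (1 ^ 2 - 2 * x * 1 + N) * (1 - beta)) by (apply Rmult_le_pos; lra).
    lra. }
  constructor; simpl; auto; [unfold N in *; rewrite <- E4 in E1; lra|].
  unfold Cmod. cbn [fst snd]. rewrite <- sqrt_1 at 1. apply sqrt_lt_1_alt.
  assert (0 < N * (beta - 1)) by (apply Rmult_lt_0_compat; lra).
  unfold N in *. split; lra.
Qed.

(** Certificate for identities modulo the cubic equation: [p] is the vanishing cubic in [alpha], [k]
    the cofactor, and [ring] checks the rest. *)
Lemma C_eq_of_multiple (k p x y : C) : p = 0%C -> (x - y = k * p)%C -> x = y.
Proof. intros Hp E. apply Ceq_minus. rewrite E, Hp. ring. Qed.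

(** By the cubic equation this is [- h1 (b alpha + 1) - h2 alpha]. The basis is chosen so that
    consecutive [T_n] become the coordinates of the powers of [alpha], see [Cpow_T]. *)
Definition latvec (a : Z) (alpha : C) (h1 h2 : Z) : C :=
  (IZR h1 * (alpha * alpha * (IZR a - alpha)) - IZR h2 * alpha)%C.

Lemma latvec_sub (a : Z) (alpha : C) (h1 h2 k1 k2 : Z) :
  (latvec a alpha h1 h2 - latvec a alpha k1 k2)%C =
  latvec a alpha (h1 - k1) (h2 - k2).
Proof. unfold latvec. rewrite !minus_IZR, !RtoC_minus. ring. Qed.

Lemma tiling_lattice_latvec (a b : Z) (alpha : C) (h1 h2 : Z) :
  (alpha * alpha * alpha = IZR a * (alpha * alpha) + IZR b * alpha + 1)%C ->
  tiling_lattice a b alpha (latvec a alpha h1 h2).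
Proof.
  (* The cubic equation gives [-alpha = alpha^2 ((1 - r2) - (1 - r1))], while [alpha^2 (1 - r1)] is
     the first basis vector. *)
  intros Hroot. exists (h1 - h2)%Z, h2.
  rewrite !Cscale_mult. simpl.
  change Cmul with Cmult. change Csub with Cminus. change Cadd with Cplus.
  change CR with RtoC. change (1, 0) with (RtoC 1).
  rewrite !minus_IZR, plus_IZR, !RtoC_minus, RtoC_plus. unfold latvec.
  apply Ceq_minus in Hroot.
  apply (C_eq_of_multiple (IZR h2 * alpha) _ _ _ Hroot). ring.
Qed.

(** Since [a - alpha] is [beta] plus the conjugate of [alpha], and [alpha] times its conjugate is
    [1 / beta], a factor [alpha] splits off. In the cofactor the imaginary part determines [h1], and
    the real part then determines [h2]. *)
Lemma latvec_factor (a b : Z) (beta : R) (alpha : C) (h1 h2 : Z) :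
  cubic_conjugate a b beta alpha ->
  latvec a alpha h1 h2 =
  (alpha * (IZR h1 * beta * fst alpha + IZR h1 / beta - IZR h2,
            IZR h1 * beta * snd alpha)%R)%C.
Proof.
  intros H. pose proof (cc_trace _ _ _ _ H) as Ht. pose proof (cc_norm _ _ _ _ H) as Hn.
  pose proof (cc_beta _ _ _ _ H) as Hb.
  unfold latvec. rewrite <- Ht. destruct alpha as [x y]. simpl in *.
  assert (E : / beta = x ^ 2 + y ^ 2)
    by (apply (Rmult_eq_reg_l beta); [rewrite Rinv_r, <- Hn; [ring|] |]; lra).
  unfold Rdiv. rewrite E.
  apply C_pair_eq; simpl; ring.
Qed.

Lemma cubic_conjugate_neq_0 (a b : Z) (beta : R) (alpha : C) :
  cubic_conjugate a b beta alpha -> alpha <> 0%C.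
Proof.
  intros H E. apply (cc_nonreal _ _ _ _ H). rewrite E. reflexivity.
Qed.

Lemma latvec_eq_0 (a b : Z) (beta : R) (alpha : C) (h1 h2 : Z) :
  cubic_conjugate a b beta alpha -> latvec a alpha h1 h2 = 0%C ->
  h1 = 0%Z /\ h2 = 0%Z.
Proof.
  intros H E. pose proof (cubic_conjugate_neq_0 _ _ _ _ H) as H0.
  rewrite (latvec_factor _ _ _ _ _ _ H) in E.
  pose proof (cc_nonreal _ _ _ _ H). pose proof (cc_beta _ _ _ _ H).
  match type of E with (_ * ?v)%C = _ => assert (Ev : v = RtoC 0) end.
  { apply Cmod_eq_0. apply (f_equal Cmod) in E. rewrite Cmod_mult, Cmod_0 in E.
    apply Cmod_gt_0 in H0. nra. }
  injection Ev as E1 E2.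
  assert (Z1 : IZR h1 = 0).
  { apply Rmult_integral in E2. destruct E2 as [E2|E2]; [|contradiction].
    apply Rmult_integral in E2. destruct E2; lra. }
  rewrite Z1 in E1. unfold Rdiv in E1.
  split; apply eq_IZR; [exact Z1|lra].
Qed.

Lemma latvec_inj (a b : Z) (beta : R) (alpha : C) (h1 h2 k1 k2 : Z) :
  cubic_conjugate a b beta alpha -> latvec a alpha h1 h2 = latvec a alpha k1 k2 ->
  h1 = k1 /\ h2 = k2.
Proof.
  intros H E. apply Ceq_minus in E. rewrite latvec_sub in E.
  apply (latvec_eq_0 _ _ _ _ _ _ H) in E. lia.
Qed.

Lemma latvec_discrete (a b : Z) (beta : R) (alpha : C) (K : R) :
  cubic_conjugate a b beta alpha ->
  exists N : Z, forall h1 h2, Cmod (latvec a alpha h1 h2) <= K ->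
    (- N <= h1 <= N /\ - N <= h2 <= N)%Z.
Proof.
  intros H. pose proof (cubic_conjugate_neq_0 _ _ _ _ H) as H0.
  apply Cmod_gt_0 in H0.
  pose proof (cc_beta _ _ _ _ H) as Hb.
  pose proof (Rabs_pos_lt _ (cc_nonreal _ _ _ _ H)) as Hy.
  (* [K1] bounds the cofactor of [alpha], [K2] bounds [h1] through its imaginary part, and [K3]
     bounds [h2] through its real part. *)
  set (K1 := K / Cmod alpha).
  set (K2 := K1 / (beta * Rabs (snd alpha))).
  set (K3 := K1 + K2 * Rabs (beta * fst alpha + / beta)).
  exists (Z.max (up K2) (up K3)). intros h1 h2 Hh.
  rewrite (latvec_factor _ _ _ _ _ _ H), Cmod_mult in Hh.
  match type of Hh with _ * Cmod ?v <= _ => set (w := v) in Hh end.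
  assert (Hw : Cmod w <= K1).
  { unfold K1. apply Rle_div_r; [exact H0|]. lra. }
  assert (B1 : Rabs (IZR h1) <= K2).
  { unfold K2. apply Rle_div_r; [nra|].
    pose proof (Rabs_snd_le_Cmod w) as Hs. simpl in Hs.
    rewrite !Rabs_mult, (Rabs_pos_eq beta) in Hs by lra. lra. }
  assert (B2 : Rabs (IZR h2) <= K3).
  { pose proof (Rabs_fst_le_Cmod w) as Hs. simpl in Hs.
    replace (IZR h2) with
      (IZR h1 * (beta * fst alpha + / beta) -
       (IZR h1 * beta * fst alpha + IZR h1 / beta - IZR h2)) by (unfold Rdiv; ring).
    unfold Rminus at 1. eapply Rle_trans; [apply Rabs_triang|].
    rewrite Rabs_Ropp, Rabs_mult. unfold K3.
    pose proof (Rabs_pos (beta * fst alpha + / beta)). nra. }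
  destruct (archimed K2) as [U2 _]. destruct (archimed K3) as [U3 _].
  apply Rabs_le_between in B1. apply Rabs_le_between in B2.
  assert (- up K2 < h1 < up K2)%Z
    by (split; apply lt_IZR; rewrite ?opp_IZR; lra).
  assert (- up K3 < h2 < up K3)%Z
    by (split; apply lt_IZR; rewrite ?opp_IZR; lra).
  lia.
Qed.

(** * Lattice points of the fractal *)

(** The default value of [nth] encodes ultimately constant sequences: the digits of the list, then
    [t] forever. *)
Lemma expansion_cons (a : Z) (alpha : C) (x t : Z) (l : list Z) :
  Cmod alpha < 1 -> bounded_digits a (fun n => nth n (x :: l) t) ->
  expansion alpha (fun n => nth n (x :: l) t) =
  (IZR x * (alpha * alpha) + alpha * expansion alpha (fun n => nth n l t))%C.
Proof. intros Hr Hd. exact (expansion_step a alpha _ Hr Hd). Qed.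

Lemma expansion_const (a : Z) (alpha : C) (t : Z) :
  Cmod alpha < 1 -> bounded_digits a (fun _ => t) ->
  ((1 - alpha) * expansion alpha (fun n => nth n [] t))%C =
  (IZR t * (alpha * alpha))%C.
Proof.
  intros Hr Hd.
  rewrite (expansion_ext alpha _ (fun _ => t)) by (intros []; reflexivity).
  pose proof (expansion_step a alpha (fun _ => t) Hr Hd) as E.
  change (shift (fun _ => t) 1) with (fun _ : nat => t) in E.
  set (X := expansion alpha (fun _ => t)) in *.
  replace ((1 - alpha) * X)%C with (X - alpha * X)%C by ring.
  rewrite E at 1. ring.
Qed.

(** The list collects the prefixes used below, with tail [0] or [a + b]. The digit [a - 1] can occur
    only at index 0 or as [t + 1] after zeros, so every maximal digit is isolated. *)
Lemma admissible_nth (a b t : Z) (l : list Z) :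
  (- a + 1 <= b <= -2)%Z ->
  (0 <= t < a - 1)%Z ->
  In l [ []; [t + 1]; [0; t + 1]; [0; 0; t + 1]; [- b - 1]; [a - 1; - b - 2] ]%Z ->
  admissible a b (fun n => nth n l t).
Proof.
  intros Hab Ht Hl. apply admissible_of_isolated_max; [lia| |].
  - intro j. destruct Hl as [<-|[<-|[<-|[<-|[<-|[<-|[]]]]]]];
      destruct j as [|[|[|[|j]]]]; simpl; lia.
  - intro j. destruct Hl as [<-|[<-|[<-|[<-|[<-|[<-|[]]]]]]];
      destruct j as [|[|[|[|j]]]]; simpl; intros E; try lia;
      (split; [lia|]); intros [|[|[|[|i]]]] Hi; simpl; lia.
Qed.

Lemma C_mult_cancel (z x y : C) : z <> 0%C -> (z * x)%C = (z * y)%C -> x = y.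
Proof.
  intros Hz E. replace x with (/ z * (z * x))%C by (field; exact Hz).
  rewrite E. field. exact Hz.
Qed.

Lemma one_minus_nonreal_neq_0 (alpha : C) : snd alpha <> 0 -> (1 - alpha)%C <> 0%C.
Proof. intros Hy E. apply (f_equal snd) in E. simpl in E. lra. Qed.

Lemma expansion_zero (a b : Z) (beta : R) (alpha : C) :
  cubic_conjugate a b beta alpha -> expansion alpha (fun n => nth n [] 0%Z) = 0%C.
Proof.
  intros H. pose proof (cc_coeff _ _ _ _ H) as Hab.
  apply (C_mult_cancel (1 - alpha)).
  - apply one_minus_nonreal_neq_0, (cc_nonreal _ _ _ _ H).
  - rewrite (expansion_const a); [ring | apply (cc_small _ _ _ _ H) | intro; lia].
Qed.

(* (a+b)^omega is the periodic tail of the beta-expansion of 1. *)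
Lemma expansion_tail (a b : Z) (beta : R) (alpha : C) :
  cubic_conjugate a b beta alpha ->
  expansion alpha (fun n => nth n [] (a + b)%Z) =
  (latvec a alpha 1 1 - alpha * alpha)%C.
Proof.
  intros H. pose proof (cc_coeff _ _ _ _ H) as Hab.
  apply (C_mult_cancel (1 - alpha)).
  - apply one_minus_nonreal_neq_0, (cc_nonreal _ _ _ _ H).
  - rewrite (expansion_const a); [| apply (cc_small _ _ _ _ H) | intro; lia].
    pose proof (cc_root _ _ _ _ H) as Hroot. apply Ceq_minus in Hroot.
    unfold latvec. rewrite plus_IZR, RtoC_plus.
    apply (C_eq_of_multiple (- alpha) _ _ _ Hroot). ring.
Qed.

(** Raising the first digit of the constant expansion by one adds [alpha^2], the term missing in
    [expansion_tail]. *)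
Lemma expansion_latvec_1_1 (a b : Z) (beta : R) (alpha : C) :
  cubic_conjugate a b beta alpha ->
  expansion alpha (fun n => nth n [a + b + 1]%Z (a + b)%Z) = latvec a alpha 1 1.
Proof.
  intros H. pose proof (cc_coeff _ _ _ _ H) as Hab.
  pose proof (cc_small _ _ _ _ H) as Hr.
  rewrite (expansion_cons a); [|exact Hr |].
  2: { apply (admissible_bounded a b), admissible_nth; [exact Hab | lia | simpl; auto]. }
  pose proof (expansion_const a alpha (a + b) Hr) as E.
  rewrite (expansion_tail _ _ _ _ H) in *.
  specialize (E ltac:(intro; lia)).
  apply Ceq_minus in E. apply Ceq_minus.
  rewrite plus_IZR, RtoC_plus, <- (Copp_0), <- E. ring.
Qed.

(** * The six neighbours *)

Definition hexagon : list (Z * Z) :=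
  [ (1, 0); (-1, 0); (1, 1); (-1, -1); (0, 1); (0, -1) ]%Z.

(** The neighbour relation in lattice coordinates, with the zero vector allowed and both points
    named, which makes it visibly symmetric. *)
Definition fractal_difference (a b : Z) (alpha : C) (h1 h2 : Z) : Prop :=
  exists z z' : C, rauzy_fractal a b alpha z /\ rauzy_fractal a b alpha z' /\
    (z - z')%C = latvec a alpha h1 h2.

Lemma fractal_difference_opp (a b : Z) (alpha : C) (h1 h2 : Z) :
  fractal_difference a b alpha h1 h2 -> fractal_difference a b alpha (- h1) (- h2).
Proof.
  intros [z [z' [Hz [Hz' E]]]]. exists z', z. do 2 (split; [assumption|]).
  replace (z' - z)%C with (- (z - z'))%C by ring. rewrite E.
  unfold latvec. rewrite !opp_IZR, !RtoC_opp. ring.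
Qed.

(** Three vectors suffice by symmetry. Each is a finite expansion minus [alpha^k u(1,1)], the value
    of [k] zeros followed by [a + b + 1] and then [a + b] forever. With
    [alpha u(1,1) = -(b + 1) alpha^2 - alpha], the words empty, [-b-1] and [(a-1)(-b-2)] for
    [k = 0, 1, 2] give [-u(1,1)], [-u(0,1)] and [u(1,0)]. *)
Lemma fractal_difference_hexagon (a b : Z) (beta : R) (alpha : C) (h1 h2 : Z) :
  cubic_conjugate a b beta alpha -> In (h1, h2) hexagon ->
  fractal_difference a b alpha h1 h2.
Proof.
  intros H. pose proof (cc_coeff _ _ _ _ H) as Hab.
  pose proof (cc_small _ _ _ _ H) as Hr.
  pose proof (cc_root _ _ _ _ H) as Hroot. apply Ceq_minus in Hroot.
  assert (Adm : forall l, In l [ []; [a + b + 1]; [0; a + b + 1]; [0; 0; a + b + 1];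
                   [- b - 1]; [a - 1; - b - 2] ]%Z ->
                admissible a b (fun n => nth n l (a + b)%Z))
    by (intros l Hl; apply admissible_nth; [exact Hab | lia | exact Hl]).
  assert (Adm0 : forall l, In l [ []; [0 + 1]; [0; 0 + 1]; [0; 0; 0 + 1];
                   [- b - 1]; [a - 1; - b - 2] ]%Z ->
                admissible a b (fun n => nth n l 0%Z))
    by (intros l Hl; apply admissible_nth; [exact Hab | lia | exact Hl]).
  assert (F : forall k1 k2 l m, admissible a b (fun n => nth n l 0%Z) ->
                admissible a b (fun n => nth n m (a + b)%Z) ->
                (expansion alpha (fun n => nth n l 0%Z) -
                 expansion alpha (fun n => nth n m (a + b)%Z))%C
                 = latvec a alpha k1 k2 -> fractal_difference a b alpha k1 k2).
  { intros k1 k2 l m Hl Hm E. do 2 eexists. split; [|split; [|exact E]];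
      now apply rauzy_fractal_expansion. }
  assert (F1 : fractal_difference a b alpha (-1) (-1)).
  { apply (F _ _ [] [a + b + 1]%Z);
      [apply Adm0; simpl; auto 10 | apply Adm; simpl; auto |].
    rewrite (expansion_zero _ _ _ _ H), (expansion_latvec_1_1 _ _ _ _ H).
    unfold latvec. ring. }
  assert (F2 : fractal_difference a b alpha 0 (-1)).
  { apply (F _ _ [- b - 1]%Z [0; a + b + 1]%Z);
      [apply Adm0; simpl; auto 10 | apply Adm; simpl; auto |].
    assert (B1 := admissible_bounded _ _ _ (Adm [0; a + b + 1]%Z ltac:(simpl; auto))).
    assert (B2 := admissible_bounded _ _ _ (Adm0 [- b - 1]%Z ltac:(simpl; auto 10))).
    rewrite (expansion_cons a alpha (- b - 1) 0 [] Hr B2),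
      (expansion_cons a alpha 0 (a + b) [a + b + 1]%Z Hr B1).
    rewrite (expansion_zero _ _ _ _ H), (expansion_latvec_1_1 _ _ _ _ H).
    unfold latvec. rewrite minus_IZR, RtoC_minus, opp_IZR, RtoC_opp.
    apply (C_eq_of_multiple (alpha) _ _ _ Hroot). ring. }
  assert (F3 : fractal_difference a b alpha 1 0).
  { apply (F _ _ [a - 1; - b - 2]%Z [0; 0; a + b + 1]%Z);
      [apply Adm0; simpl; auto 10 | apply Adm; simpl; auto |].
    assert (B1 := admissible_bounded _ _ _ (Adm [0; 0; a + b + 1]%Z ltac:(simpl; auto))).
    assert (B2 := admissible_bounded _ _ _ (Adm [0; a + b + 1]%Z ltac:(simpl; auto))).
    assert (B3 := Adm0 [a - 1; - b - 2]%Z ltac:(simpl; auto 10)).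
    assert (B4 := admissible_bounded _ _ _ (admissible_shift _ _ _ 1 B3)).
    rewrite (expansion_cons a alpha (a - 1) 0 [- b - 2]%Z Hr (admissible_bounded _ _ _ B3)),
      (expansion_cons a alpha (- b - 2) 0 [] Hr B4),
      (expansion_cons a alpha 0 (a + b) [0; a + b + 1]%Z Hr B1),
      (expansion_cons a alpha 0 (a + b) [a + b + 1]%Z Hr B2),
      (expansion_zero _ _ _ _ H).
    rewrite (expansion_latvec_1_1 _ _ _ _ H).
    unfold latvec. rewrite !minus_IZR, !RtoC_minus, opp_IZR, RtoC_opp.
    apply (C_eq_of_multiple (alpha * alpha) _ _ _ Hroot). ring. }
  intros [E|[E|[E|[E|[E|[E|[]]]]]]]; injection E as <- <-; auto.
  - apply (fractal_difference_opp _ _ _ _ _ F3).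
  - apply (fractal_difference_opp _ _ _ _ _ F1).
  - apply (fractal_difference_opp _ _ _ _ _ F2).
Qed.

(** A counting argument: the hexagon gives six distinct neighbours, so a complete list of length six
    lies in its image. *)
Lemma fractal_difference_classify (a b : Z) (beta : R) (alpha : C) (h1 h2 : Z) :
  cubic_conjugate a b beta alpha -> six_neighbours a b alpha ->
  fractal_difference a b alpha h1 h2 -> In (h1, h2) ((0, 0)%Z :: hexagon).
Proof.
  intros H [l [Hlen [Hnd Hl]]] Hd.
  set (v := fun h : Z * Z => latvec a alpha (fst h) (snd h) : C).
  assert (Hinj : forall h k, v h = v k -> h = k).
  { intros [x1 x2] [y1 y2] E. apply (latvec_inj _ _ _ _ _ _ _ _ H) in E.
    simpl in E. destruct E; congruence. }
  assert (Hv0 : v (0, 0)%Z = 0%C) by (unfold v, latvec; simpl; ring).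
  assert (Hn : forall h, fractal_difference a b alpha (fst h) (snd h) ->
                 h <> (0, 0)%Z -> In (v h) l).
  { intros h [z [z' [Hz [Hz' E]]]] Hh. apply Hl. split; [|split].
    - apply tiling_lattice_latvec, (cc_root _ _ _ _ H).
    - intros E0. apply Hh, Hinj. rewrite Hv0. exact E0.
    - exists z. split; [exact Hz|].
      replace (Csub z (v h)) with z'; [exact Hz'|].
      change (@eq C z' (z - v h)%C). unfold v. rewrite <- E. ring. }
  assert (Hincl : incl l (map v hexagon)).
  { apply NoDup_length_incl.
    - apply Injective_map_NoDup; [exact Hinj|].
      repeat constructor; simpl; intuition discriminate.
    - rewrite Hlen. reflexivity.
    - intros u Hu. apply in_map_iff in Hu. destruct Hu as [[k1 k2] [<- Hk]].
      apply Hn.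
      + exact (fractal_difference_hexagon _ _ _ _ _ _ H Hk).
      + intros [= -> ->]. simpl in Hk. intuition discriminate. }
  destruct (Z.eq_dec h1 0) as [E1|E1], (Z.eq_dec h2 0) as [E2|E2];
    [left; congruence | right | right | right];
    (assert (Hin : In (v (h1, h2)) (map v hexagon))
       by (apply Hincl, Hn; [exact Hd | congruence]);
     apply in_map_iff in Hin; destruct Hin as [k [Ek Hk]];
     apply Hinj in Ek; subst k; exact Hk).
Qed.

Lemma latvec_in_fractal (a b : Z) (beta : R) (alpha : C) (h1 h2 : Z) :
  cubic_conjugate a b beta alpha -> six_neighbours a b alpha ->
  rauzy_fractal a b alpha (latvec a alpha h1 h2) ->
  (h1 = 0 /\ h2 = 0 \/ h1 = 1 /\ h2 = 1)%Z.
Proof.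
  intros H H6 Hf. pose proof (cc_coeff _ _ _ _ H) as Hab.
  pose proof (cc_small _ _ _ _ H) as Hr.
  pose proof (cubic_conjugate_neq_0 _ _ _ _ H) as Hnz.
  pose proof (cc_root _ _ _ _ H) as Hroot. apply Ceq_minus in Hroot.
  assert (F0 : rauzy_fractal a b alpha (RtoC 0)).
  { rewrite <- (expansion_zero _ _ _ _ H).
    apply rauzy_fractal_expansion; [exact Hr|].
    apply admissible_nth; [exact Hab | lia | simpl; auto]. }
  assert (F1 : rauzy_fractal a b alpha (latvec a alpha 1 1)).
  { rewrite <- (expansion_latvec_1_1 _ _ _ _ H).
    apply rauzy_fractal_expansion; [exact Hr|].
    apply admissible_nth; [exact Hab | lia | simpl; auto]. }
  assert (Ft : rauzy_fractal a b alpha (latvec a alpha 1 1 - alpha * alpha)%C).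
  { rewrite <- (expansion_tail _ _ _ _ H).
    apply rauzy_fractal_expansion; [exact Hr|].
    apply admissible_nth; [exact Hab | lia | simpl; auto]. }
  assert (Cl : forall k1 k2 (z z' : C), rauzy_fractal a b alpha z ->
             rauzy_fractal a b alpha z' -> (z - z')%C = latvec a alpha k1 k2 ->
             In (k1, k2) ((0, 0)%Z :: hexagon)).
  { intros k1 k2 z z' Hz Hz' E.
    apply (fractal_difference_classify _ _ _ _ _ _ H H6). exists z, z'. auto. }
  assert (C0 := Cl h1 h2 _ _ Hf F0 ltac:(ring)).
  assert (C1 := Cl _ _ _ _ Hf F1 (latvec_sub _ _ _ _ _ _)).
  assert (D : (h1 = 0 /\ h2 = 0 \/ h1 = 1 /\ h2 = 1 \/
               h1 = 0 /\ h2 = 1 \/ h1 = 1 /\ h2 = 0)%Z).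
  { simpl in C0, C1.
    repeat (destruct C0 as [C0|C0]; [injection C0 as <- <-;
      first [lia | repeat (destruct C1 as [C1|C1]; [discriminate C1|]); contradiction]|]).
    contradiction. }
  destruct D as [D|[D|D]]; [auto | auto | exfalso].
  destruct (rauzy_fractal_inv _ _ _ _ Hf) as [e [He E]].
  rewrite (expansion_step a alpha e Hr (proj1 He)) in E.
  pose proof (rauzy_fractal_expansion a b alpha _ Hr (admissible_shift _ _ _ 1 He)) as Hs.
  set (s := expansion alpha (shift e 1)) in *.
  pose proof (proj1 He O) as Hd.
  destruct D as [[-> ->]|[-> ->]].
  (* Here [-alpha = e_0 alpha^2 + alpha s], so [s = -1 - e_0 alpha]. Its second coordinate [e_0 - b]
     is at least 2, outside the hexagon. *)
  - assert (Es : s = latvec a alpha 1 (e O - b)).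
    { apply (C_mult_cancel alpha); [exact Hnz|].
      replace (alpha * s)%C with (latvec a alpha 0 1 - IZR (e O) * (alpha * alpha))%C
        by (rewrite E; ring).
      unfold latvec. rewrite minus_IZR, RtoC_minus.
      apply (C_eq_of_multiple alpha _ _ _ Hroot). ring. }
    assert (C2 := Cl 1%Z (e O - b)%Z s 0%C Hs F0 ltac:(rewrite Es; ring)).
    simpl in C2.
    repeat (destruct C2 as [C2|C2]; [injection C2; lia|]). contradiction.
  (* Here [s = (a - e_0) alpha - alpha^2]. The second coordinate [e_0 - a - 1] is at most -2, again
     outside the hexagon. *)
  - assert (Es : (s - (latvec a alpha 1 1 - alpha * alpha))%C =
                 latvec a alpha (-1) (e O - a - 1)).
    { apply (C_mult_cancel alpha); [exact Hnz|].
      replace (alpha * (s - (latvec a alpha 1 1 - alpha * alpha)))%C with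
        (latvec a alpha 1 0 - IZR (e O) * (alpha * alpha)
         - alpha * (latvec a alpha 1 1 - alpha * alpha))%C
        by (rewrite E; ring).
      unfold latvec. rewrite !minus_IZR, !RtoC_minus. ring. }
    assert (C2 := Cl _ _ _ _ Hs Ft Es). simpl in C2.
    repeat (destruct C2 as [C2|C2]; [injection C2; lia|]). contradiction.
Qed.

(** * Compactness *)

(** Takes the minimum of finitely many positive constants, adding one integer at a time. It also
    serves as the pigeonhole principle for the choice of a next digit. *)
Lemma uniform_positive (P : Z -> R -> Prop) (lo hi : Z) :
  (forall x c c', 0 < c' <= c -> P x c -> P x c') ->
  (forall x, (lo <= x <= hi)%Z -> exists c, 0 < c /\ P x c) ->
  exists c, 0 < c /\ forall x, (lo <= x <= hi)%Z -> P x c.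
Proof.
  intros Hmono Hex.
  assert (G : forall n, exists c, 0 < c /\
            forall x, (lo <= x <= hi)%Z -> (x < lo + Z.of_nat n)%Z -> P x c).
  { induction n as [|n [c [Hc IH]]].
    - exists 1. split; [lra|]. intros; lia.
    - destruct (Z_le_gt_dec (lo + Z.of_nat n) hi) as [L|L].
      + destruct (Hex (lo + Z.of_nat n)%Z ltac:(lia)) as [c' [Hc' Hx]].
        exists (Rmin c c'). split; [now apply Rmin_glb_lt|].
        intros x Hx1 Hx2.
        pose proof (Rmin_l c c'). pose proof (Rmin_r c c').
        pose proof (Rmin_glb_lt c c' 0 Hc Hc').
        destruct (Z.eq_dec x (lo + Z.of_nat n)) as [->|N].
        * apply (Hmono _ c'); [lra | exact Hx].
        * apply (Hmono _ c); [lra |]. apply IH; lia.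
      + exists c. split; [exact Hc|]. intros x Hx1 Hx2. apply IH; lia. }
  destruct (G (Z.to_nat (hi - lo + 1))) as [c [Hc Hx]].
  exists c. split; [exact Hc|]. intros x Hxx. apply Hx; [exact Hxx | lia].
Qed.

(** The nodes of the tree for Koenig's lemma: [l] can be continued, in a way depending on [eps], to
    values arbitrarily close to [u]. *)
Definition approximable (a b : Z) (alpha u : C) (l : list Z) : Prop :=
  forall eps, 0 < eps -> exists d, admissible a b d /\
    (forall i, (i < length l)%nat -> d i = nth i l 0%Z) /\
    Cmod (expansion alpha d - u)%C < eps.

(** If each of the finitely many next digits failed at some tolerance, all would fail at a common
    one, which contradicts the approximability of [l]. *)
Lemma approximable_extend (a b : Z) (alpha u : C) (l : list Z) :
  approximable a b alpha u l -> exists x, approximable a b alpha u (l ++ [x]).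
Proof.
  intros Hl. apply NNPP. intros Hno.
  destruct (uniform_positive (fun x c => ~ exists d, admissible a b d /\
    (forall i, (i < length (l ++ [x]))%nat -> d i = nth i (l ++ [x]) 0%Z) /\
    Cmod (expansion alpha d - u)%C < c) 0 (a - 1)) as [c [Hc Hx]].
  - intros x c c' Hcc HP [d [H1 [H2 H3]]]. apply HP. exists d.
    split; [exact H1|]. split; [exact H2 | lra].
  - intros x _. apply NNPP. intros HN. apply Hno. exists x.
    intros eps Heps. apply NNPP. intros HN'. apply HN. exists eps. auto.
  - destruct (Hl c Hc) as [d [H1 [H2 H3]]].
    apply (Hx (d (length l))); [apply H1|].
    exists d. split; [exact H1|]. split; [|exact H3].
    intros i Hi. rewrite length_app in Hi. simpl in Hi.
    destruct (Nat.eq_dec i (length l)) as [->|N].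
    + rewrite app_nth2, Nat.sub_diag by lia. reflexivity.
    + rewrite app_nth1 by lia. apply H2. lia.
Qed.

(* Koenig's lemma: an infinite branch of approximable prefixes expands the limit. *)
Lemma rauzy_fractal_closed (a b : Z) (alpha u : C) :
  Cmod alpha < 1 -> approximable a b alpha u [] -> rauzy_fractal a b alpha u.
Proof.
  intros Hr H0.
  set (next := fun l => epsilon (inhabits 0%Z)
                 (fun x => approximable a b alpha u (l ++ [x]))).
  set (branch := fix branch n := match n with
                   | O => [] | S n => branch n ++ [next (branch n)] end).
  set (e := fun n => next (branch n)).
  assert (Hlen : forall n, length (branch n) = n).
  { induction n as [|n IH]; simpl; [reflexivity|]. rewrite length_app, IH. simpl; lia. }
  assert (Hap : forall n, approximable a b alpha u (branch n)).
  { induction n as [|n IH]; simpl; [exact H0|].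
    apply (epsilon_spec (inhabits 0%Z)
      (fun x => approximable a b alpha u (branch n ++ [x]))).
    now apply approximable_extend. }
  assert (Hnth : forall n i, (i < n)%nat -> nth i (branch n) 0%Z = e i).
  { induction n as [|n IH]; intros i Hi; [lia|]. simpl.
    destruct (Nat.eq_dec i n) as [->|N].
    - rewrite app_nth2, Hlen, Nat.sub_diag by (rewrite Hlen; lia). reflexivity.
    - rewrite app_nth1 by (rewrite Hlen; lia). apply IH. lia. }
  assert (Hd : forall n eps, 0 < eps -> exists d, admissible a b d /\
            (forall i, (i < n)%nat -> d i = e i) /\
            Cmod (expansion alpha d - u)%C < eps).
  { intros n eps Heps. destruct (Hap n eps Heps) as [d [H1 [H2 H3]]].
    exists d. split; [exact H1|]. split; [|exact H3].
    intros i Hi. rewrite H2 by (rewrite Hlen; exact Hi). now apply Hnth. }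
  (* Each condition involves only digits of index at most [j], and there [e] agrees with an
     admissible sequence. *)
  assert (He : admissible a b e).
  { split.
    - intro j. destruct (Hd (S j) 1 Rlt_0_1) as [d [H1 [H2 _]]].
      rewrite <- H2 by lia. apply H1.
    - intros j m Hm. destruct (Hd (S j) 1 Rlt_0_1) as [d [H1 [H2 _]]].
      apply (lexle_ext _ (fun t => d (j - t)%nat)).
      + intros t Ht. apply H2. lia.
      + now apply H1. }
  enough (E : expansion alpha e = u)
    by (rewrite <- E; now apply rauzy_fractal_expansion).
  apply Ceq_minus, Cmod_eq_0.
  pose proof (Cmod_ge_0 (expansion alpha e - u)%C) as Hge.
  destruct (Rle_lt_or_eq_dec _ _ Hge) as [Hpos|]; [exfalso | congruence].
  set (eta := Cmod (expansion alpha e - u)%C) in *.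
  set (B := 2 * (IZR (a - 1) / (1 - Cmod alpha))).
  assert (HB : forall f, admissible a b f -> Cmod (expansion alpha f) <= B)
    by (intros f Hf; apply Cmod_expansion_le;
        [exact Hr | exact (admissible_bounded _ _ _ Hf)]).
  assert (HB0 : 0 <= B) by (eapply Rle_trans; [apply Cmod_ge_0 | apply (HB e He)]).
  (* With [n] this large each tail contributes less than [eta / 4], and [d] is within [eta / 2] of
     [u], which contradicts the definition of [eta]. Using [B + 1] keeps the denominator
     positive. *)
  destruct (pow_lt_1_zero (Cmod alpha)
              ltac:(rewrite Rabs_pos_eq; [exact Hr | apply Cmod_ge_0])
              (eta / (4 * (B + 1))) ltac:(apply Rdiv_lt_0_compat; lra)) as [n Hn].
  specialize (Hn n (Nat.le_refl n)).
  rewrite Rabs_pos_eq in Hn by (apply pow_le, Cmod_ge_0).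
  apply Rlt_div_r in Hn; [|lra].
  destruct (Hd n (eta / 2) ltac:(lra)) as [d [H1 [H2 H3]]].
  assert (E : (expansion alpha e - u =
    Cpow alpha n * expansion alpha (shift e n)
    + (- (Cpow alpha n * expansion alpha (shift d n)) + (expansion alpha d - u)))%C).
  { rewrite (expansion_split a alpha e n Hr (proj1 He)).
    rewrite (expansion_split a alpha d n Hr (proj1 H1)).
    rewrite (expansion_prefix_ext alpha d e n H2). ring. }
  assert (eta <= Cmod alpha ^ n * B + (Cmod alpha ^ n * B + eta / 2)).
  { unfold eta at 1. rewrite E.
    pose proof (pow_le (Cmod alpha) n (Cmod_ge_0 alpha)) as Hp.
    eapply Rle_trans; [apply Cmod_triangle|]. apply Rplus_le_compat.
    - rewrite Cmod_mult, Cmod_Cpow. apply Rmult_le_compat_l; [exact Hp|].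
      apply HB. now apply admissible_shift.
    - eapply Rle_trans; [apply Cmod_triangle|].
      apply Rplus_le_compat; [|lra].
      rewrite Cmod_opp, Cmod_mult, Cmod_Cpow. apply Rmult_le_compat_l; [exact Hp|].
      apply HB. now apply admissible_shift. }
  pose proof (pow_le (Cmod alpha) n (Cmod_ge_0 alpha)). lra.
Qed.

(** Only finitely many lattice points lie within distance 1 of the bounded fractal. Each of them
    other than [u(0,0)] and [u(1,1)] has positive distance from it by closedness. *)
Lemma latvec_near_fractal (a b : Z) (beta : R) (alpha : C) :
  cubic_conjugate a b beta alpha -> six_neighbours a b alpha ->
  exists c, 0 < c /\ forall d h1 h2, admissible a b d ->
    Cmod (expansion alpha d - latvec a alpha h1 h2)%C < c ->
    (h1 = 0 /\ h2 = 0 \/ h1 = 1 /\ h2 = 1)%Z.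
Proof.
  intros H H6. pose proof (cc_small _ _ _ _ H) as Hr.
  set (B := 2 * (IZR (a - 1) / (1 - Cmod alpha))).
  destruct (latvec_discrete _ _ _ _ (B + 1) H) as [N HN].
  set (P := fun h1 h2 c => forall d, admissible a b d ->
     Cmod (expansion alpha d - latvec a alpha h1 h2)%C < c ->
     (h1 = 0 /\ h2 = 0 \/ h1 = 1 /\ h2 = 1)%Z).
  assert (Hmono : forall h1 h2 c c', 0 < c' <= c -> P h1 h2 c -> P h1 h2 c').
  { intros h1 h2 c c' Hc HP d Hd Hlt. apply (HP d Hd). lra. }
  assert (Hpt : forall h1 h2, exists c, 0 < c /\ P h1 h2 c).
  (* If no tolerance works, [u(h)] is a limit of points of the fractal, hence belongs to it. Then
     [h] is one of the allowed pairs, and every tolerance works. *)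
  { intros h1 h2. apply NNPP. intros Hno.
    assert (G : (h1 = 0 /\ h2 = 0 \/ h1 = 1 /\ h2 = 1)%Z).
    { apply (latvec_in_fractal _ _ _ _ _ _ H H6).
      apply rauzy_fractal_closed; [exact Hr|].
      intros eps Heps. apply NNPP. intros HN'. apply Hno. exists eps.
      split; [exact Heps|]. intros d Hd Hlt. exfalso. apply HN'.
      exists d. split; [exact Hd|]. split; [intros i Hi; simpl in Hi; lia | exact Hlt]. }
    apply Hno. exists 1. split; [lra|]. intros d _ _. exact G. }
  destruct (uniform_positive (fun h1 c => forall h2, (- N <= h2 <= N)%Z -> P h1 h2 c)
              (- N) N) as [c [Hc HP]].
  - intros h1 c c' Hcc HPc h2 Hh2. apply (Hmono _ _ c); auto.
  - intros h1 _. apply uniform_positive; [apply Hmono | auto].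
  (* The bound 1 keeps [u(h)] in the ball of radius [B + 1] for which [N] was chosen. *)
  - exists (Rmin c 1). split; [apply Rmin_glb_lt; lra|].
    intros d h1 h2 Hd Hlt. pose proof (Rmin_l c 1). pose proof (Rmin_r c 1).
    destruct (HN h1 h2) as [N1 N2].
    + replace (latvec a alpha h1 h2) with
        (expansion alpha d + - (expansion alpha d - latvec a alpha h1 h2))%C by ring.
      eapply Rle_trans; [apply Cmod_triangle|]. rewrite Cmod_opp.
      pose proof (Cmod_expansion_le a alpha d Hr (proj1 Hd)). unfold B. lra.
    + apply (HP h1 N1 h2 N2 d Hd). lra.
Qed.

(** * The Rauzy norm *)

Lemma T_step (a b : Z) (n : nat) :
  T a b (S (S (S n))) = (a * T a b (S (S n)) + b * T a b (S n) + T a b n)%Z.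
Proof. unfold T. simpl. destruct (Ttrip a b n) as [[x y] z]. reflexivity. Qed.

(** Multiplication by [alpha], reduced by the cubic equation, acts on these coordinates as the
    recurrence of [T]. *)
Lemma Cpow_T (a b : Z) (alpha : C) (n : nat) :
  (alpha * alpha * alpha = IZR a * (alpha * alpha) + IZR b * alpha + 1)%C ->
  Cpow alpha (n + 4) =
  (IZR (T a b (S (S n))) * (alpha * alpha)
   - latvec a alpha (T a b (S n)) (T a b n))%C.
Proof.
  intros Hroot. apply Ceq_minus in Hroot.
  induction n as [|n IH].
  - unfold T. simpl. change Cmul with Cmult. change (1, 0) with (RtoC 1).
    unfold latvec. rewrite plus_IZR, mult_IZR, RtoC_plus, RtoC_mult.
    apply (C_eq_of_multiple alpha _ _ _ Hroot). ring.
  - change (Cpow alpha (S n + 4)) with (Cmult alpha (Cpow alpha (n + 4))).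
    rewrite IH, T_step. unfold latvec.
    rewrite !plus_IZR, !mult_IZR, !RtoC_plus, !RtoC_mult.
    apply (C_eq_of_multiple (IZR (T a b (S n)) * alpha) _ _ _ Hroot). ring.
Qed.

Lemma expansion_prefix_sumZ (a b : Z) (alpha : C) (d : nat -> Z) (n : nat) :
  (alpha * alpha * alpha = IZR a * (alpha * alpha) + IZR b * alpha + 1)%C ->
  expansion_prefix alpha d (S (S n)) =
  (IZR (sumZ (fun j => d j * T a b j)%Z (S (S n))) * (alpha * alpha)
   - latvec a alpha (sumZ (fun j => d (S j) * T a b j)%Z (S n))
                    (sumZ (fun j => d (S (S j)) * T a b j)%Z n))%C.
Proof.
  intros Hroot. induction n as [|n IH].
  (* The digits of index 0 and 1 contribute through [alpha^2] and
     [alpha^3 = T_1 alpha^2 - u(T_0, 0)]. *)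
  - unfold T. simpl. change Cmul with Cmult. change (1, 0) with (RtoC 1).
    unfold latvec. rewrite !plus_IZR, !mult_IZR, !RtoC_plus, !RtoC_mult. ring.
  - change (expansion_prefix alpha d (S (S (S n)))) with
      (expansion_prefix alpha d (S (S n)) +
       IZR (d (S (S n))) * Cpow alpha (S (S n) + 2))%C.
    rewrite IH. replace (S (S n) + 2)%nat with (n + 4)%nat by lia.
    rewrite (Cpow_T a b alpha n Hroot).
    change (sumZ (fun j => d j * T a b j)%Z (S (S (S n)))) with
      (sumZ (fun j => d j * T a b j)%Z (S (S n)) + d (S (S n)) * T a b (S (S n)))%Z.
    change (sumZ (fun j => d (S j) * T a b j)%Z (S (S n))) with
      (sumZ (fun j => d (S j) * T a b j)%Z (S n) + d (S (S n)) * T a b (S n))%Z.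
    change (sumZ (fun j => d (S (S j)) * T a b j)%Z (S n)) with
      (sumZ (fun j => d (S (S j)) * T a b j)%Z n + d (S (S n)) * T a b n)%Z.
    unfold latvec. rewrite !(plus_IZR (sumZ _ _)), !mult_IZR, !RtoC_plus, !RtoC_mult.
    ring.
Qed.

Lemma expansion_Trep (a b : Z) (beta : R) (alpha : C) (q : Z) (d : nat -> Z) (k : nat) :
  cubic_conjugate a b beta alpha -> Trep a b q d k ->
  expansion alpha d =
  (IZR q * (alpha * alpha)
   - latvec a alpha (sumZ (fun j => d (S j) * T a b j)%Z k)
                    (sumZ (fun j => d (S (S j)) * T a b j)%Z k))%C.
Proof.
  intros H [Hd [Hk Hq]].
  (* A prefix of length [k + 2] fits the previous lemma with [n = k]; the extra digit [d (k + 1)] is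
     zero, which reconciles the lengths of the sums. *)
  rewrite (expansion_split a alpha d (S (S k)) (cc_small _ _ _ _ H) (proj1 Hd)).
  rewrite (expansion_ext alpha (shift d (S (S k))) (fun n => nth n [] 0%Z)).
  2: { intro i. unfold shift. rewrite Hk by lia. destruct i; reflexivity. }
  rewrite (expansion_zero _ _ _ _ H),
    (expansion_prefix_sumZ a b alpha d k (cc_root _ _ _ _ H)).
  replace (sumZ (fun j => d j * T a b j)%Z (S (S k))) with q.
  2: { rewrite Hq. simpl. rewrite (Hk (S k)) by lia. ring. }
  replace (sumZ (fun j => d (S j) * T a b j)%Z (S k)) with
    (sumZ (fun j => d (S j) * T a b j)%Z k).
  2: { simpl. rewrite (Hk (S k)) by lia. ring. }
  ring.
Qed.

(* The complex conjugate of the linear form inside the norm, multiplied by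
   -alpha beta, is the difference on the right. *)
Lemma rauzy_norm_latvec (a b : Z) (beta : R) (alpha : C) (q g1 g2 : Z) :
  cubic_conjugate a b beta alpha ->
  Cmod alpha * beta *
    rauzy_norm b beta alpha (IZR q / beta - IZR g1, IZR q / beta ^ 2 - IZR g2) =
  Cmod (IZR q * (alpha * alpha) - latvec a alpha g1 g2)%C.
Proof.
  intros H. pose proof (cc_beta _ _ _ _ H) as Hb.
  pose proof (cubic_conjugate_neq_0 _ _ _ _ H) as Hnz.
  set (alphac := Cconj alpha).
  assert (Hcnz : alphac <> 0%C).
  { intros E. apply Hnz. rewrite <- (Cconj_conj alpha). unfold alphac in E.
    rewrite E. apply C_pair_eq; simpl; ring. }
  (* Vieta's formulas express [a], [b] and [beta] through [alpha] and its conjugate, leaving a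
     rational identity for [field]. *)
  assert (Et : RtoC (IZR a) = (RtoC beta + alpha + alphac)%C).
  { apply C_pair_eq; simpl; rewrite <- ?(cc_trace _ _ _ _ H); ring. }
  assert (Es : RtoC (IZR b) = (- (RtoC beta * (alpha + alphac) + alpha * alphac))%C).
  { apply C_pair_eq; simpl; rewrite ?(cc_pairs _ _ _ _ H); ring. }
  assert (En : RtoC beta = (/ (alpha * alphac))%C).
  { apply (C_mult_cancel (alpha * alphac)); [now apply Cmult_neq_0|].
    rewrite Cinv_r by now apply Cmult_neq_0.
    apply C_pair_eq; simpl; [rewrite <- (cc_norm _ _ _ _ H)|]; ring. }
  unfold rauzy_norm. rewrite Cscale_mult. cbn [fst snd].
  match goal with |- _ * Cnorm ?w = _ => set (z := w : C) end.
  change (Cnorm z) with (Cmod z). rewrite <- (Cmod_conj z).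
  replace beta with (Cmod (RtoC beta)) at 1 by (rewrite Cmod_R, Rabs_pos_eq; lra).
  rewrite <- !Cmod_mult, <- Cmod_opp. f_equal.
  replace (Cconj z) with
    (RtoC (IZR q / beta - IZR g1) * (alphac + RtoC (IZR b / beta))
     + RtoC ((IZR q / beta ^ 2 - IZR g2) / beta))%C
    by (apply C_pair_eq; unfold z, alphac; simpl; ring).
  unfold latvec.
  rewrite !RtoC_div, !RtoC_minus, !RtoC_div, RtoC_pow by (try apply pow_nonzero; lra).
  rewrite Et, Es, En. field.
  repeat split; auto; now apply Cmult_neq_0.
Qed.

Theorem theorem3p1 :
  forall (a b : Z) (beta : R) (alpha : R * R),
    (- a + 1 <= b <= -2)%Z ->
    (* beta is a real root of x^3 - a x^2 - b x - 1, dominant *)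
    beta ^ 3 - IZR a * beta ^ 2 - IZR b * beta - 1 = 0 ->
    Cnorm alpha < beta ->
    (* alpha is a non-real root (so alpha, conj alpha are the conjugates of beta) *)
    Cchar a b alpha = (0, 0) ->
    snd alpha <> 0 ->
    (* standing assumption: the Rauzy fractal has exactly 6 neighbours *)
    six_neighbours a b alpha ->
    exists c : R, 0 < c /\
      forall (q : Z) (g : Z * Z), (0 < q)%Z ->
        let x := (IZR q / beta - IZR (fst g), IZR q / beta ^ 2 - IZR (snd g)) in
        rauzy_norm b beta alpha x < c ->
        forall (d : nat -> Z) (k : nat), Trep a b q d k ->
          x = delta a b beta q d k \/
          x = Csub (delta a b beta q d k) (1, 1).
Proof.
  intros a b beta alpha Hab Hbeta _ Hchar Hy H6.
  pose proof (cubic_conjugate_intro a b beta alpha Hab Hbeta Hchar Hy) as H.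
  destruct (latvec_near_fractal a b beta alpha H H6) as [c [Hc Hnear]].
  pose proof (cc_beta _ _ _ _ H) as Hb.
  pose proof (proj1 (Cmod_gt_0 alpha) (cubic_conjugate_neq_0 _ _ _ _ H)) as Ha.
  assert (Hab' : 0 < Cmod alpha * beta) by (apply Rmult_lt_0_compat; lra).
  (* The denominator is the scaling factor of [rauzy_norm_latvec]. *)
  exists (c / (Cmod alpha * beta)). split; [now apply Rdiv_lt_0_compat|].
  intros q [g1 g2] _ x Hx d k Hrep. cbn [fst snd] in x.
  apply Rlt_div_r in Hx; [|exact Hab'].
  rewrite Rmult_comm in Hx. unfold x in Hx.
  rewrite (rauzy_norm_latvec a b beta alpha q g1 g2 H) in Hx.
  set (s1 := sumZ (fun j => d (S j) * T a b j)%Z k).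
  set (s2 := sumZ (fun j => d (S (S j)) * T a b j)%Z k).
  (* As the expansion of [d] is [q alpha^2 - u(s1,s2)], its difference from [u(g1 - s1, g2 - s2)] is
     the quantity [q alpha^2 - u(g1,g2)] bounded in [Hx]. *)
  destruct (Hnear d (g1 - s1)%Z (g2 - s2)%Z (proj1 Hrep)) as [[E1 E2]|[E1 E2]].
  - rewrite (expansion_Trep a b beta alpha q d k H Hrep), <- latvec_sub.
    fold s1 s2.
    match goal with |- Cmod ?w < _ =>
      replace w with (IZR q * (alpha * alpha) - latvec a alpha g1 g2)%C by ring end.
    exact Hx.
  - left. unfold x, delta. fold s1 s2.
    replace g1 with s1 by lia. replace g2 with s2 by lia. reflexivity.
  - right. unfold x, delta, Csub. fold s1 s2. cbn [fst snd].
    replace g1 with (s1 + 1)%Z by lia. replace g2 with (s2 + 1)%Z by lia.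
    rewrite !plus_IZR. f_equal; ring.
Qed.
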